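(* Let $\mathcal{U}\in \mathbb{C}^{I_1\times\cdots\times I_M \times J_1\times\cdots\times J_N}$, $\mathcal{V}\in \mathbb{C}^{J_1\times\cdots\times J_N \times K_1\times\cdots\times K_L}$ and $\mathcal{W} \in \mathbb{C}^{K_1\times\cdots\times K_L \times H_1\times\cdots\times H_R}$. Let $\mathcal{A} = \mathcal{U}*_N\mathcal{V}*_L\mathcal{W}$, and let $\mathcal{M} \in \mathbb{C}^{I_1\times\cdots\times I_M \times I_1 \times\cdots\times I_M}$, $\mathcal{N} \in \mathbb{C}^{H_1\times\cdots\times H_R \times H_1 \times\cdots\times H_R}$ be a pair of Hermitian positive definite tensors. Then $$\mathcal{A}^\dagger_{\mathcal{M},\mathcal{N}} = \mathcal{X}^\dagger_{\mathcal{I}_N,\mathcal{N}}*_N\mathcal{V}*_L \mathcal{Y}^\dagger_{\mathcal{M},\mathcal{I}_L},$$ where $\mathcal{X} = \mathcal{U}^\dagger*_M\mathcal{A}$ and $\mathcal{Y} = \mathcal{A}*_R\mathcal{W}^\dagger$.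
   Context: Einstein product: for $\mathcal{A}\in\mathbb{C}^{I_1\times\cdots\times I_M\times J_1\times\cdots\times J_N}$ and $\mathcal{B}\in\mathbb{C}^{J_1\times\cdots\times J_N\times K_1\times\cdots\times K_L}$, $(\mathcal{A}*_N\mathcal{B})_{i_1\ldots i_Mk_1\ldots k_L}=\sum_{j_1,\ldots,j_N}a_{i_1\ldots i_Mj_1\ldots j_N}b_{j_1\ldots j_Nk_1\ldots k_L}$ (the subscript is the number of contracted indices; similarly $*_M,*_L,*_R$). The conjugate transpose $\mathcal{A}^*$ has entries $(\mathcal{A}^* )_{j_1\ldots j_Ni_1\ldots i_M}=\overline{a_{i_1\ldots i_Mj_1\ldots j_N}}$. $\mathcal{I}_N$ and $\mathcal{I}_L$ are the identity tensors of $\mathbb{C}^{J_1\times\cdots\times J_N\times J_1\times\cdots\times J_N}$ and $\mathbb{C}^{K_1\times\cdots\times K_L\times K_1\times\cdots\times K_L}$ (entries: products of Kronecker deltas). A tensor $\mathcal{P}$ with the same row and column index sets is Hermitian positive definite if $\mathcal{P}=\mathcal{Z}*\mathcal{D}*\mathcal{Z}^*$ (Einstein products over all the row indices) with $\mathcal{Z}$ unitary ($\mathcal{Z}*\mathcal{Z}^*=\mathcal{Z}^**\mathcal{Z}$ is the identity tensor) and $\mathcal{D}$ a diagonal tensor with positive diagonal entries. Weighted Moore-Penrose inverse: for $\mathcal{A}\in\mathbb{C}^{I_1\times\cdots\times I_M\times J_1\times\cdots\times J_N}$ and Hermitian positive definite $\mathcal{M}\in\mathbb{C}^{I_1\times\cdots\times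 I_M\times I_1\times\cdots\times I_M}$, $\mathcal{N}\in\mathbb{C}^{J_1\times\cdots\times J_N\times J_1\times\cdots\times J_N}$, $\mathcal{A}^\dagger_{\mathcal{M},\mathcal{N}}$ is the unique $\mathcal{Y}\in\mathbb{C}^{J_1\times\cdots\times J_N\times I_1\times\cdots\times I_M}$ with $\mathcal{A}*_N\mathcal{Y}*_M\mathcal{A}=\mathcal{A}$, $\mathcal{Y}*_M\mathcal{A}*_N\mathcal{Y}=\mathcal{Y}$, $(\mathcal{M}*_M\mathcal{A}*_N\mathcal{Y})^*=\mathcal{M}*_M\mathcal{A}*_N\mathcal{Y}$, $(\mathcal{N}*_N\mathcal{Y}*_M\mathcal{A})^*=\mathcal{N}*_N\mathcal{Y}*_M\mathcal{A}$; the same definition applies with other index sets. The Moore-Penrose inverse $\mathcal{A}^\dagger$ is the case where both weights are identity tensors. *)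

(* Defs.v *)
From HB Require Import structures.
From mathcomp Require Import all_boot all_order all_algebra.
From mathcomp Require Export complex.
From mathcomp Require Import boolp classical_sets.
From mathcomp Require Export reals.

Set Implicit Arguments.
Unset Strict Implicit.
Unset Printing Implicit Defensive.

Import Order.TTheory GRing.Theory Num.Theory.
Local Open Scope ring_scope.

Declare Scope tensor_scope.
Delimit Scope tensor_scope with T.

(* The multi-indices (i_1, ..., i_m) with i_k < I_k. *)
Definition mindex m (I : 'I_m -> nat) : Type := {dffun forall k, 'I_(I k)}.
HB.instance Definition _ m (I : 'I_m -> nat) := Finite.on (mindex I).

(* C^(I_1 x ... x I_m x J_1 x ... x J_n). The split of the indices into row
   and column indices is part of the type: the entry a_(i_1..i_m j_1..j_n) is
   A (i, j) with i : mindex I and j : mindex J. *)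
Definition tensor (C : Type) m n (I : 'I_m -> nat) (J : 'I_n -> nat) : Type :=
  {ffun mindex I * mindex J -> C}.
HB.instance Definition _ (C : nmodType) m n (I : 'I_m -> nat) (J : 'I_n -> nat) :=
  GRing.Nmodule.on (tensor C I J).

Section Tensors.
Variable C : numClosedFieldType.

(* The number n of contracted indices is determined by the shape J. *)
Definition einstein m n l (I : 'I_m -> nat) (J : 'I_n -> nat) (K : 'I_l -> nat)
    (A : tensor C I J) (B : tensor C J K) : tensor C I K :=
  [ffun ik => \sum_(j : mindex J) A (ik.1, j) * B (j, ik.2)].

Definition ctran m n (I : 'I_m -> nat) (J : 'I_n -> nat)
    (A : tensor C I J) : tensor C J I :=
  [ffun ji => (A (ji.2, ji.1))^*].

Definition idt n (J : 'I_n -> nat) : tensor C J J :=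
  [ffun ij : mindex J * mindex J => \prod_(k < n) (ij.1 k == ij.2 k)%:R].

End Tensors.

Arguments idt {C n} J.

Notation "A *e B" := (einstein A B)
  (at level 40, left associativity) : tensor_scope.
Notation "A ^H" := (ctran A) (at level 2, format "A ^H") : tensor_scope.
Local Open Scope tensor_scope.

Section WeightedMoorePenrose.
Variable C : numClosedFieldType.

Definition unitary n (J : 'I_n -> nat) (Z : tensor C J J) : Prop :=
  Z *e Z^H = idt J /\ Z^H *e Z = idt J.

Definition diagonal n (J : 'I_n -> nat) (D : tensor C J J) : Prop :=
  forall i j : mindex J, i != j -> D (i, j) = 0.

(* In C, 0 < z means that z is real and positive. *)
Definition hermitian_posdef n (J : 'I_n -> nat) (P : tensor C J J) : Prop :=
  exists Z D : tensor C J J,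
    [/\ unitary Z, diagonal D, (forall i : mindex J, 0 < D (i, i))
      & P = Z *e D *e Z^H].

Definition is_wmpinv m n (I : 'I_m -> nat) (J : 'I_n -> nat)
    (M : tensor C I I) (N : tensor C J J) (A : tensor C I J)
    (Y : tensor C J I) : Prop :=
  [/\ A *e Y *e A = A,
      Y *e A *e Y = Y,
      (M *e A *e Y)^H = M *e A *e Y
    & (N *e Y *e A)^H = N *e Y *e A].

(* For Hermitian positive definite M and N there is exactly one Y with
   is_wmpinv M N A Y; the default value 0 is only used for other weights. *)
Definition wmpinv m n (I : 'I_m -> nat) (J : 'I_n -> nat)
    (M : tensor C I I) (N : tensor C J J) (A : tensor C I J) : tensor C J I :=
  xget 0 [set Y | is_wmpinv M N A Y]%classic.

Definition mpinv m n (I : 'I_m -> nat) (J : 'I_n -> nat)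
    (A : tensor C I J) : tensor C J I :=
  wmpinv (idt I) (idt J) A.

End WeightedMoorePenrose.

(* Main.v *)
(** Identify tensors with matrices by enumerating multi-indices. A weighted
    Moore-Penrose inverse is then unique, and for a full-rank factorization
    [A = F G] it is [N^-1 G^H (F^H M A N^-1 G^H)^-1 F^H M]. For the theorem put
    [Z = X' V Y'], where [X'] and [Y'] are the two weighted inverses on the
    right. The projector [U^+ U] is absorbed by [X'] and [W W^+] by [Y'], which
    gives [A Z = Y Y'] and [Z A = X' X]; the four equations for [Z] follow. *)

Require Import Defs.
From mathcomp Require Import all_boot all_order all_algebra.
From mathcomp Require Import complex reals.
From mathcomp Require Import boolp classical_sets.

Set Implicit Arguments.
Unset Strict Implicit.
Unset Printing Implicit Defensive.

Import Order.TTheory GRing.Theory Num.Theory.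

Local Open Scope ring_scope.
Local Open Scope tensor_scope.

(** * Hermitian forms and Gram matrices *)

Section Matrices.
Variable C : numClosedFieldType.

Definition conjtr p q (A : 'M[C]_(p, q)) : 'M[C]_(q, p) := (map_mx Num.conj A)^T.
Local Notation "A ^*m" := (conjtr A) (at level 2, format "A ^*m").

Lemma conjtrM p q s (A : 'M[C]_(p, q)) (B : 'M[C]_(q, s)) :
  (A *m B)^*m = B^*m *m A^*m.
Proof. by rewrite /conjtr map_mxM trmx_mul. Qed.

Lemma conjtrK p q (A : 'M[C]_(p, q)) : A^*m^*m = A.
Proof. by apply/matrixP => i j; rewrite !mxE conjCK. Qed.

Lemma conjtr1 p : (1%:M : 'M[C]_p)^*m = 1%:M.
Proof. by rewrite /conjtr map_mx1 trmx1. Qed.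

Lemma conjtr_invmx p (B : 'M[C]_p) :
  B \in unitmx -> B^*m = B -> (invmx B)^*m = invmx B.
Proof.
move=> uB hB; apply: (can_inj (mulKmx uB)); rewrite mulmxV // -{1}hB.
by rewrite -conjtrM mulVmx // conjtr1.
Qed.

(** The form in which positive definiteness of a weight is used: it makes Gram matrices invertible
    and passes to the inverse weight. *)
Definition hermitian_anisotropic p (P : 'M[C]_p) : Prop :=
  P^*m = P /\ forall v : 'rV_p, v *m P *m v^*m = 0 -> v = 0.

Lemma row_free_inj0 p q (A : 'M[C]_(p, q)) :
  (forall v : 'rV_p, v *m A = 0 -> v = 0) -> row_free A.
Proof.
move=> A0; rewrite -kermx_eq0; apply/eqP/row_matrixP => i.
by rewrite row0; apply: A0; rewrite -row_mul mulmx_ker row0.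
Qed.

(** If [v] kills the Gram matrix, the form of [P] vanishes at [v *m B]; hence [v *m B = 0], and
    [v = 0] by row freeness. *)
Lemma anisotropic_gram_unit p q (P : 'M[C]_q) (B : 'M[C]_(p, q)) :
  hermitian_anisotropic P -> row_free B -> B *m P *m B^*m \in unitmx.
Proof.
move=> [_ P0] freeB; rewrite -row_free_unit; apply: row_free_inj0 => v vBPB.
apply: (row_free_inj freeB); rewrite mul0mx; apply: P0.
by rewrite conjtrM !mulmxA -(mulmxA v) -(mulmxA v) mulmxA -(mulmxA v) vBPB mul0mx.
Qed.

Lemma anisotropic_unit p (P : 'M[C]_p) : hermitian_anisotropic P -> P \in unitmx.
Proof.
move=> aP; have := @anisotropic_gram_unit _ _ P 1%:M aP.
by rewrite conjtr1 mul1mx mulmx1 row_free_unit; apply; apply: unitmx1.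
Qed.

Lemma anisotropic_inv p (P : 'M[C]_p) :
  hermitian_anisotropic P -> hermitian_anisotropic (invmx P).
Proof.
move=> aP; have [hP P0] := aP; have uP := anisotropic_unit aP.
have hPV := conjtr_invmx uP hP.
(* The form of [P] at [v *m invmx P] equals the form of [invmx P] at [v]. *)
split=> // v vPv; suff : v *m invmx P = 0.
  by move=> /(congr1 (mulmx^~ P)); rewrite mulmxKV // mul0mx.
by apply: P0; rewrite conjtrM hPV mulmxKV // mulmxA.
Qed.

(** With [w = v *m Z] the form is the sum of the [|w_j|^2 D_jj]. These terms are nonnegative, so a
    zero sum forces [w = 0], and then [v = w *m Z^*m = 0]. *)
Lemma spectral_anisotropic p (Z D : 'M[C]_p) :
  Z *m Z^*m = 1%:M -> is_diag_mx D -> (forall i, 0 < D i i) ->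
  hermitian_anisotropic (Z *m D *m Z^*m).
Proof.
move=> ZZ /is_diag_mxP diagD D_gt0.
have hD : D^*m = D.
  apply/matrixP => i j; rewrite !mxE; have [->|neq_ij] := eqVneq i j.
    exact/CrealP/gtr0_real/D_gt0.
  by rewrite !diagD ?conjC0 // eq_sym.
split; first by rewrite !conjtrM conjtrK hD mulmxA.
move=> v vZDZv; suff vZ : v *m Z = 0 by rewrite -[v]mulmx1 -ZZ mulmxA vZ mul0mx.
have : v *m Z *m D *m (v *m Z)^*m = 0 by rewrite conjtrM !mulmxA in vZDZv *.
move: (v *m Z) => w /matrixP/(_ 0 0); rewrite mxE mxE.
under eq_bigr => j _.
  rewrite mxE (bigD1 j) //= big1 ?addr0; last first.
    by move=> k neq_kj; rewrite diagD ?mulr0.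
  rewrite !mxE mulrAC -normCK; over.
move=> w0; apply/rowP => j; rewrite mxE; apply/eqP.
have ge0 k : true -> 0 <= `|w 0 k| ^+ 2 * D k k.
  by move=> _; rewrite mulr_ge0 ?exprn_ge0 // ltW.
have /eqP : `|w 0 j| ^+ 2 * D j j = 0 by exact: (psumr_eq0P ge0 w0).
by rewrite mulf_eq0 (gt_eqF (D_gt0 j)) orbF expf_eq0 normr_eq0.
Qed.

Lemma anisotropic1 p : hermitian_anisotropic (1%:M : 'M[C]_p).
Proof.
have /= := @spectral_anisotropic p 1%:M 1%:M.
rewrite conjtr1 !mulmx1; apply=> [//||i]; first exact: scalar_mx_is_diag.
by rewrite mxE eqxx ltr01.
Qed.

(** * Weighted Moore-Penrose inverses of matrices *)

Definition is_wmpinv_mx p q (M : 'M[C]_p) (N : 'M[C]_q) (A : 'M[C]_(p, q))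
    (Y : 'M[C]_(q, p)) : Prop :=
  [/\ A *m Y *m A = A,
      Y *m A *m Y = Y,
      (M *m A *m Y)^*m = M *m A *m Y
    & (N *m Y *m A)^*m = N *m Y *m A].

Lemma is_wmpinv_mx_exists p q (M : 'M[C]_p) (N : 'M[C]_q) (A : 'M[C]_(p, q)) :
  hermitian_anisotropic M -> hermitian_anisotropic N ->
  exists Y, is_wmpinv_mx M N A Y.
Proof.
move=> aM aN; have [hM _] := aM; have aNV := anisotropic_inv aN.
have uN := anisotropic_unit aN; have [hNV _] := aNV.
have freeF : row_free (col_base A)^*m.
  have /row_fullP[B BF] := col_base_full A.
  by apply/row_freeP; exists B^*m; rewrite -conjtrM BF conjtr1.
have := row_base_free A; have := mulmx_base A.
move: (\rank A) (col_base A) (row_base A) freeF => k F G freeF AE freeG.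
have := anisotropic_gram_unit aM freeF.
have := anisotropic_gram_unit aNV freeG.
rewrite conjtrK; set S := G *m _ *m _; set T := F^*m *m _ *m _ => uS uT.
have hS : S^*m = S by rewrite /S !conjtrM conjtrK hNV mulmxA.
have hT : T^*m = T by rewrite /T !conjtrM conjtrK hM mulmxA.
(* Since [A = F *m G], the middle factor F^H M A N^-1 G^H is [T *m S], a product of two invertible
   Gram matrices, so its inverse is [invmx S *m invmx T]. *)
pose Y := invmx N *m G^*m *m invmx S *m invmx T *m F^*m *m M.
have GY : G *m Y = invmx T *m F^*m *m M.
  by rewrite /Y !mulmxA -/S mulmxV // mul1mx.
have YF : Y *m F = invmx N *m G^*m *m invmx S.
  by rewrite /Y -!mulmxA (mulmxA _ M) -/T mulVmx // mulmx1.
have AY : A *m Y = F *m invmx T *m F^*m *m M by rewrite -AE -(mulmxA F G) GY !mulmxA.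
have YA : Y *m A = invmx N *m G^*m *m invmx S *m G by rewrite -AE mulmxA YF.
exists Y; split.
- by rewrite AY -AE -!mulmxA (mulmxA M) (mulmxA F^*m) (mulmxA F^*m) -/T mulKmx.
- rewrite YA -!mulmxA GY /Y.
  by rewrite !mulmxA.
- by rewrite -mulmxA AY !conjtrM conjtrK hM conjtr_invmx // !mulmxA.
- rewrite -mulmxA YA !mulmxA mulmxV // mul1mx.
  by rewrite !conjtrM conjtrK conjtr_invmx // mulmxA.
Qed.

(** Both inverses define the same projectors A Y and Y A, whence Y1 = Y1 A Y1 = Y2 A Y1 = Y2 A Y2 =
    Y2. *)
Lemma is_wmpinv_mx_unique p q (M : 'M[C]_p) (N : 'M[C]_q) (A : 'M[C]_(p, q)) Y1 Y2 :
  hermitian_anisotropic M -> hermitian_anisotropic N ->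
  is_wmpinv_mx M N A Y1 -> is_wmpinv_mx M N A Y2 -> Y1 = Y2.
Proof.
move=> aM aN [e1 f1 g1 h1] [e2 f2 g2 h2].
have [[hM _] [hN _]] := (aM, aN).
have AY : A *m Y1 = A *m Y2.
  apply: (can_inj (mulKmx (anisotropic_unit aM))); rewrite !mulmxA.
  have m1 : M *m A *m Y1 = Y1^*m *m A^*m *m M by rewrite -g1 !conjtrM hM mulmxA.
  have m2 : M *m A *m Y2 = Y2^*m *m A^*m *m M by rewrite -g2 !conjtrM hM mulmxA.
  (* By [m2] this is M A Y2 A Y1 = M A Y1; by [m1] it is (A Y1 A Y2)^H M = (A Y2)^H M = M A Y2. *)
  transitivity (Y2^*m *m A^*m *m (M *m A *m Y1)).
    by rewrite !mulmxA -m2 -!mulmxA (mulmxA A Y2) (mulmxA (A *m Y2)) e2.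
  by rewrite m1 m2 !mulmxA -3!conjtrM !mulmxA e1 conjtrM.
have YA : Y1 *m A = Y2 *m A.
  apply: (can_inj (mulKmx (anisotropic_unit aN))); rewrite !mulmxA.
  have n1 : N *m Y1 *m A = A^*m *m Y1^*m *m N by rewrite -h1 !conjtrM hN mulmxA.
  have n2 : N *m Y2 *m A = A^*m *m Y2^*m *m N by rewrite -h2 !conjtrM hN mulmxA.
  transitivity (A^*m *m Y1^*m *m (N *m Y2 *m A)).
    by rewrite !mulmxA -n1 -!mulmxA (mulmxA A) e2.
  by rewrite n2 !mulmxA -3!conjtrM (mulmxA A) e1 conjtrM.
by rewrite -f1 YA -mulmxA AY mulmxA f2.
Qed.

Lemma is_wmpinv_mx_triple p q s t (M : 'M[C]_p) (N : 'M[C]_t) (U : 'M[C]_(p, q))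
    (V : 'M[C]_(q, s)) (W : 'M[C]_(s, t)) A X Y U' W' X' Y' :
  A = U *m V *m W -> X = U' *m A -> Y = A *m W' ->
  is_wmpinv_mx 1%:M 1%:M U U' -> is_wmpinv_mx 1%:M 1%:M W W' ->
  is_wmpinv_mx 1%:M N X X' -> is_wmpinv_mx M 1%:M Y Y' ->
  is_wmpinv_mx M N A (X' *m V *m Y').
Proof.
move=> AE XE YE [U1 U2 _ U4] [W1 W2 W3 _] [X1 X2 X3 X4] [Y1 Y2 Y3 Y4].
rewrite !mul1mx in U4 W3 X3 Y4.
have AUX : A = U *m X by rewrite XE AE !mulmxA U1.
have AYW : A = Y *m W by rewrite YE AE -!mulmxA (mulmxA W) W1.
have PX : U' *m U *m X = X by rewrite XE !mulmxA U2.
have YQ : Y *m (W *m W') = Y by rewrite YE -!mulmxA (mulmxA W') W2.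
(* Write P = U' U. Both P and X X' are Hermitian and P X = X, so X X' P = (P X X')^H = X X';
   multiply by X' on the left. The argument for [QY'] is the mirror image. *)
have X'P : X' *m (U' *m U) = X'.
  suff XX'P : X *m X' *m (U' *m U) = X *m X'.
    by rewrite -{1}X2 -2!mulmxA (mulmxA X) XX'P mulmxA X2.
  by rewrite -X3 -{1}U4 -conjtrM mulmxA PX.
have QY' : W *m W' *m Y' = Y'.
  suff QY'Y : W *m W' *m (Y' *m Y) = Y' *m Y.
    by rewrite -{1}Y2 mulmxA QY'Y Y2.
  by rewrite -Y4 -{1}W3 -conjtrM -mulmxA YQ.
have XWY : X *m W' = U' *m Y by rewrite XE YE mulmxA.
(* Inserting the absorbed projectors on both sides of V turns it into U' U V W W' = U' A W' = X
   W'. *)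
have ZE : X' *m V *m Y' = X' *m (X *m W') *m Y'.
  by rewrite -{1}X'P -{1}QY' XE AE !mulmxA.
(* U X X' X W' Y' collapses to U X W' Y' = A W' Y'. *)
have AZ : A *m (X' *m V *m Y') = Y *m Y'.
  rewrite ZE {1}AUX !mulmxA -(mulmxA U X X') -(mulmxA U _ X) X1 -AUX.
  by rewrite YE.
(* By [XWY] the product is X' U' Y Y' Y W, which collapses to X' U' Y W = X' U' A. *)
have ZA : X' *m V *m Y' *m A = X' *m X.
  by rewrite ZE XWY {1}AYW -!mulmxA (mulmxA Y) (mulmxA (Y *m Y')) Y1 -AYW -XE.
split.
- by rewrite AZ {1}AYW mulmxA Y1 -AYW.
- by rewrite ZA !mulmxA X2.
- by rewrite -mulmxA AZ mulmxA.
- by rewrite -mulmxA ZA mulmxA.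
Qed.

End Matrices.

Local Notation "A ^*m" := (conjtr A) (at level 2, format "A ^*m").

(** * Flattening tensors to matrices *)

Section TensorsAsMatrices.
Variable C : numClosedFieldType.

Definition tensor_mx m n (I : 'I_m -> nat) (J : 'I_n -> nat) (A : tensor C I J) :
    'M[C]_(#|{: mindex I}|, #|{: mindex J}|) :=
  \matrix_(i, j) A (enum_val i, enum_val j).

Definition mx_tensor m n (I : 'I_m -> nat) (J : 'I_n -> nat)
    (A : 'M[C]_(#|{: mindex I}|, #|{: mindex J}|)) : tensor C I J :=
  [ffun ij => A (enum_rank ij.1) (enum_rank ij.2)].

Lemma tensor_mxK m n (I : 'I_m -> nat) (J : 'I_n -> nat) :
  cancel (@tensor_mx _ _ I J) (@mx_tensor _ _ I J).
Proof. by move=> A; apply/ffunP => -[i j]; rewrite ffunE mxE !enum_rankK. Qed.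

Lemma mx_tensorK m n (I : 'I_m -> nat) (J : 'I_n -> nat) :
  cancel (@mx_tensor _ _ I J) (@tensor_mx _ _ I J).
Proof. by move=> A; apply/matrixP => i j; rewrite mxE ffunE !enum_valK. Qed.

Lemma tensor_mxM m n l (I : 'I_m -> nat) (J : 'I_n -> nat) (K : 'I_l -> nat)
    (A : tensor C I J) (B : tensor C J K) :
  tensor_mx (A *e B) = tensor_mx A *m tensor_mx B.
Proof.
apply/matrixP => i k; rewrite !mxE ffunE (reindex _ (onW_bij _ (@enum_val_bij _))).
by apply: eq_bigr => j _; rewrite !mxE.
Qed.

Lemma tensor_mxH m n (I : 'I_m -> nat) (J : 'I_n -> nat) (A : tensor C I J) :
  tensor_mx A^H = (tensor_mx A)^*m.
Proof. by apply/matrixP => i j; rewrite !mxE ffunE. Qed.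

Lemma idtE n (J : 'I_n -> nat) (i j : mindex J) :
  (idt J : tensor C J J) (i, j) = (i == j)%:R.
Proof.
rewrite ffunE /=; have [->|neq_ij] := eqVneq i j.
  by rewrite big1 // => k _; rewrite eqxx.
(* One differing coordinate contributes a zero factor to the product of deltas. *)
have [k neq_k] : exists k, i k != j k.
  apply/existsP; apply: contraNT neq_ij => /existsPn eq_ij.
  by apply/eqP/ffunP => k; apply/eqP/negPn/eq_ij.
by rewrite (bigD1 k) //= (negPf neq_k) mul0r.
Qed.

Lemma tensor_mx1 n (J : 'I_n -> nat) :
  tensor_mx (idt J : tensor C J J) = 1%:M.
Proof.
by apply/matrixP => i j; rewrite !mxE idtE (inj_eq enum_val_inj).
Qed.

Lemma posdef_anisotropic n (J : 'I_n -> nat) (P : tensor C J J) :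
  hermitian_posdef P -> hermitian_anisotropic (tensor_mx P).
Proof.
move=> [Z [D [[ZZ _] diagD D_gt0 ->]]]; rewrite !tensor_mxM tensor_mxH.
apply: spectral_anisotropic => [||i].
- by rewrite -tensor_mxH -tensor_mxM ZZ tensor_mx1.
- apply/is_diag_mxP => i j neq_ij; rewrite mxE diagD //.
  by rewrite (inj_eq enum_val_inj).
- by rewrite mxE.
Qed.

Lemma is_wmpinv_tensor_mx m n (I : 'I_m -> nat) (J : 'I_n -> nat)
    (M : tensor C I I) (N : tensor C J J) (A : tensor C I J) (Y : tensor C J I) :
  is_wmpinv M N A Y <->
  is_wmpinv_mx (tensor_mx M) (tensor_mx N) (tensor_mx A) (tensor_mx Y).
Proof.
rewrite /is_wmpinv_mx -!tensor_mxM -!tensor_mxH.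
split=> [[-> -> -> ->] //|[e1 e2 e3 e4]].
by split; apply: (can_inj (@tensor_mxK _ _ _ _)).
Qed.

Lemma wmpinvP m n (I : 'I_m -> nat) (J : 'I_n -> nat)
    (M : tensor C I I) (N : tensor C J J) (A : tensor C I J) :
  hermitian_anisotropic (tensor_mx M) -> hermitian_anisotropic (tensor_mx N) ->
  is_wmpinv_mx (tensor_mx M) (tensor_mx N) (tensor_mx A)
    (tensor_mx (wmpinv M N A)).
Proof.
move=> aM aN; apply/is_wmpinv_tensor_mx.
have [Y wY] := is_wmpinv_mx_exists (tensor_mx A) aM aN.
(* A matrix solution, folded back into a tensor, shows the set is nonempty, so [xget] returns one of
   its elements rather than the default 0. *)
apply: (@xgetPex _ 0 [set Y | is_wmpinv M N A Y]%classic); exists (mx_tensor Y).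
by apply/is_wmpinv_tensor_mx; rewrite mx_tensorK.
Qed.

End TensorsAsMatrices.

Theorem theorem8 (R : realType) (m n l r : nat)
    (I : 'I_m -> nat) (J : 'I_n -> nat) (K : 'I_l -> nat) (H : 'I_r -> nat)
    (U : tensor R[i] I J) (V : tensor R[i] J K) (W : tensor R[i] K H)
    (M : tensor R[i] I I) (N : tensor R[i] H H) :
  hermitian_posdef M -> hermitian_posdef N ->
  let A := U *e V *e W in
  let X := mpinv U *e A in
  let Y := A *e mpinv W in
  wmpinv M N A = wmpinv (idt J) N X *e V *e wmpinv M (idt K) Y.
Proof.
move=> /posdef_anisotropic aM /posdef_anisotropic aN A X Y.
have aI k (L : 'I_k -> nat) :
    hermitian_anisotropic (tensor_mx (idt L : tensor R[i] L L)).
  by rewrite tensor_mx1; apply: anisotropic1.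
have wU : is_wmpinv_mx _ _ _ (tensor_mx (mpinv U)) := wmpinvP U (aI _ _) (aI _ _).
have wW : is_wmpinv_mx _ _ _ (tensor_mx (mpinv W)) := wmpinvP W (aI _ _) (aI _ _).
have wX := wmpinvP X (aI _ _) aN; have wY := wmpinvP Y aM (aI _ _).
apply: (can_inj (@tensor_mxK _ _ _ _ _)).
(* By uniqueness it remains to check the four equations for the flattened right-hand side. *)
apply: (is_wmpinv_mx_unique aM aN (wmpinvP A aM aN)).
rewrite !tensor_mx1 in wU wW wX wY.
rewrite !tensor_mxM in wX wY *.
exact: is_wmpinv_mx_triple erefl erefl erefl wU wW wX wY.
Qed.
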